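(* Let $w \in \mathbb{N}$ be a speculation window and $\Phi : \mathbb{N} \to \{\mathit{jump}, \mathit{next}\}$ a branch predictor. For every program $P$, all memories $m_1, m_2 : \mathbb{N} \to \mathbb{Z}$, all register assignments $a_1, a_2 : \{r_1, r_2\} \to \mathbb{Z}$, every cache $c$ and every program counter $\mathit{pc} \in \mathbb{N}$, the always-mispredict contract system $\mathcal{C}_P$ and the speculating hardware system $\mathcal{H}_P$ satisfy $$[\![ ((m_1, a_1, \mathit{pc}), \infty, \bot) ]\!]_{\mathcal{C}_P} = [\![ ((m_2, a_2, \mathit{pc}), \infty, \bot) ]\!]_{\mathcal{C}_P} \implies [\![ ((m_1, a_1, \mathit{pc}, c), \infty, \bot) ]\!]_{\mathcal{H}_P} = [\![ ((m_2, a_2, \mathit{pc}, c), \infty, \bot) ]\!]_{\mathcal{H}_P}.$$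
   Context: A (deterministic) transition system consists of states, observations, and functions $\mathit{next}$ and $\mathit{leak}$ on states; writing $q \xrightarrow{o} q'$ means $q' = \mathit{next}(q)$ and $o = \mathit{leak}(q)$. The infinite trace $[\![ q ]\!]$ is the sequence $\mathit{leak}(q)\ \mathit{leak}(\mathit{next}(q))\ \mathit{leak}(\mathit{next}^2(q))\ldots$ ISA. Registers are $r_1, r_2$. Instructions are $\mathbf{load}\ x_1, x_2$; $\mathbf{add}\ x_1, x_2, k$; and $\mathbf{beqz}\ x, l$, with $x, x_1, x_2 \in \{r_1,r_2\}$, $k \in \mathbb{Z}$, $l \in \mathbb{N}$. A program $P$ assigns to each location $n \in \mathbb{N}$ an instruction $P(n)$. An architectural state is $\sigma = (m, a, \mathit{pc})$ with memory $m : \mathbb{N} \to \mathbb{Z}$, registers $a : \{r_1,r_2\} \to \mathbb{Z}$ and $\mathit{pc} \in \mathbb{N}$; its components are written $\sigma.a$, $\sigma.\mathit{pc}$, etc., and $\sigma[\mathit{pc} \mapsto n]$ is $\sigma$ with program counter $n$. For $v \in \mathbb{Z}$ let $\overline{v} = \max(v,0)$ (negative values used as addresses are truncated to $0$). Single-instruction architectural semantics $(\sigma, i) \Rightarrow_{\mathit{isa}} \sigma'$, for $\sigma = (m,a,\mathit{pc})$: - $i = \mathbf{add}\ x_1,x_2,k$: $\sigma' = (m, a[x_1 \mapsto a(x_2)+k], \mathit{pc}+1)$; - $i = \mathbf{load}\ x_1,x_2$: $\sigma' = (m, a[x_1 \mapsto m(\overline{a(x_2)})], \mathit{pc}+1)$;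 - $i = \mathbf{beqz}\ x,l$: $\sigma' = (m,a,l)$ if $a(x)=0$, and $\sigma' = (m,a,\mathit{pc}+1)$ otherwise. A vanilla hardware state is $s = (\sigma, c)$, also written $(m,a,\mathit{pc},c)$, where the cache $c$ is a finite list of addresses. Single-instruction hardware semantics $(s,i) \Rightarrow_{\mathcal H}^{c} s'$ (observation label $c$, the current cache): if $(\sigma,i) \Rightarrow_{\mathit{isa}} \sigma'$, then $s' = (\sigma', \overline{a(x_2)} :: c)$ when $i = \mathbf{load}\ x_1,x_2$, and $s' = (\sigma', c)$ otherwise. Convention: $\infty + 1 = \infty$. The same constant $w$ is used in both systems below. Always-mispredict contract $\mathcal{C}_P$. States are $(\sigma, \infty, \bot)$ or $(\sigma, \omega, \sigma_b)$ with $\omega \in \mathbb{N}$ and $\sigma_b$ an architectural state. Observations are integers, Booleans, or $\bot$ (all distinct). Transitions: - Step: if ($\sigma_b \neq \bot$ or $P(\sigma.\mathit{pc})$ is not a $\mathbf{beqz}$) and $(\sigma, P(\sigma.\mathit{pc})) \Rightarrow_{\mathit{isa}} \sigma'$, then $(\sigma, \omega+1, \sigma_b) \xrightarrow{o} (\sigma', \omega, \sigma_b)$, where $o = \sigma.a(x_2)$ if $P(\sigma.\mathit{pc}) = \mathbf{load}\ x_1,x_2$; $o$ is the Boolean truth value of $\sigma.a(x) = 0$ if $P(\sigma.\mathit{pc}) = \mathbf{beqz}\ x,l$; and $o=\bot$ otherwise. - Rollback: $(\sigma, 0, \sigma_b) \xrightarrow{\bot} (\sigma_b, \infty, \bot)$.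 - Branch: if $P(\sigma.\mathit{pc}) = \mathbf{beqz}\ x,l$, $(\sigma, \mathbf{beqz}\ x,l) \Rightarrow_{\mathit{isa}} \sigma'$, and $\mathit{pc}_\bot$ is $\sigma.\mathit{pc}+1$ if $\sigma.a(x)=0$ and $l$ otherwise, then $(\sigma,\infty,\bot) \xrightarrow{o} (\sigma[\mathit{pc} \mapsto \mathit{pc}_\bot], w, \sigma')$ with $o$ the truth value of $\sigma.a(x)=0$. Speculating hardware $\mathcal{H}_P$ (with predictor $\Phi$). States are $(s, \infty, \bot)$ or $(s, \omega, (\mathsf{b}, \sigma_b))$ with $s$ a vanilla hardware state, $\omega \in \mathbb{N}$, $\mathsf{b}$ a Boolean and $\sigma_b$ an architectural state. Write $\mathsf{cp}$ for the third component. Transitions: - Rollback: $(s,0,(\mathsf{false},\sigma_b)) \xrightarrow{s.c} ((\sigma_b, s.c), \infty, \bot)$. - Commit: $(s,0,(\mathsf{true},\sigma_b)) \xrightarrow{s.c} (s,\infty,\bot)$. - Step: if ($\mathsf{cp} \neq \bot$ or $P(s.\mathit{pc})$ is not a $\mathbf{beqz}$) and $(s, P(s.\mathit{pc})) \Rightarrow_{\mathcal H}^{o} s'$, then $(s,\omega+1,\mathsf{cp}) \xrightarrow{o} (s',\omega,\mathsf{cp})$. - Branch Next: if $P(s.\mathit{pc}) = \mathbf{beqz}\ x,l$, $\Phi(s.\mathit{pc}) = \mathit{next}$, $\sigma'$ is the architectural state resulting from executing this instruction from $s$, and $\mathsf{b}$ is the truth value of $\sigma'.\mathit{pc} = s.\mathit{pc}+1$,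 then $(s,\infty,\bot) \xrightarrow{s.c} (s[\mathit{pc} \mapsto s.\mathit{pc}+1], w, (\mathsf{b},\sigma'))$. - Branch Jump: if $P(s.\mathit{pc}) = \mathbf{beqz}\ x,l$, $\Phi(s.\mathit{pc}) = \mathit{jump}$, $\sigma'$ is as before, and $\mathsf{b}$ is the truth value of $\sigma'.\mathit{pc} = l$, then $(s,\infty,\bot) \xrightarrow{s.c} (s[\mathit{pc} \mapsto l], w, (\mathsf{b},\sigma'))$. *)

(* Defs.v *)
From Stdlib Require Import ZArith List Bool.
Import ListNotations.

Record transition_system : Type := TransitionSystem {
  ts_state : Type;
  ts_obs : Type;
  next : ts_state -> ts_state;
  leak : ts_state -> ts_obs
}.

Definition transition (T : transition_system)
    (q : ts_state T) (o : ts_obs T) (q' : ts_state T) : Prop :=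
  q' = next T q /\ o = leak T q.

(* Infinite sequences are functions from nat, compared pointwise. *)
Definition trace (T : transition_system) (q : ts_state T) (n : nat) : ts_obs T :=
  leak T (Nat.iter n (next T) q).

Inductive reg : Type := r1 | r2.

Definition reg_eqb (x y : reg) : bool :=
  match x, y with
  | r1, r1 | r2, r2 => true
  | _, _ => false
  end.

Inductive instr : Type :=
  | ILoad (x1 x2 : reg)
  | IAdd (x1 x2 : reg) (k : Z)
  | IBeqz (x : reg) (l : nat).

Definition program : Type := nat -> instr.
Definition memory : Type := nat -> Z.
Definition registers : Type := reg -> Z.

Record arch_state : Type := Arch {
  st_mem : memory;
  st_regs : registers;
  st_pc : nat
}.

Definition set_pc (s : arch_state) (n : nat) : arch_state :=
  Arch (st_mem s) (st_regs s) n.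

Definition upd (a : registers) (x : reg) (v : Z) : registers :=
  fun y => if reg_eqb x y then v else a y.

(* [Z.to_nat] sends negative integers to 0, so this is max(v, 0) as a nat. *)
Definition addr (v : Z) : nat := Z.to_nat v.

Definition is_zero (s : arch_state) (x : reg) : bool := Z.eqb (st_regs s x) 0.

Definition isa_step (s : arch_state) (i : instr) : arch_state :=
  let (m, a, pc) := s in
  match i with
  | IAdd x1 x2 k => Arch m (upd a x1 (a x2 + k)%Z) (S pc)
  | ILoad x1 x2 => Arch m (upd a x1 (m (addr (a x2)))) (S pc)
  | IBeqz x l => Arch m a (if Z.eqb (a x) 0 then l else S pc)
  end.

Definition is_beqz (i : instr) : bool :=
  match i with IBeqz _ _ => true | _ => false end.

Definition fetch (P : program) (s : arch_state) : instr := P (st_pc s).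

Definition cache : Type := list nat.

Record hw_state : Type := HW {
  hw_arch : arch_state;
  hw_cache : cache
}.

(* The observation label of this step is the current cache [hw_cache s]. *)
Definition hw_step (s : hw_state) (i : instr) : hw_state :=
  HW (isa_step (hw_arch s) i)
     (match i with
      | ILoad _ x2 => addr (st_regs (hw_arch s) x2) :: hw_cache s
      | _ => hw_cache s
      end).

Definition hw_set_pc (s : hw_state) (n : nat) : hw_state :=
  HW (set_pc (hw_arch s) n) (hw_cache s).

Inductive contract_obs : Type :=
  | ObsInt (v : Z)
  | ObsBool (b : bool)
  | ObsBot.

Definition instr_obs (s : arch_state) (i : instr) : contract_obs :=
  match i with
  | ILoad _ x2 => ObsInt (st_regs s x2)
  | IBeqz x _ => ObsBool (is_zero s x)
  | IAdd _ _ _ => ObsBot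
  end.

(* [CArch s] is (s, oo, bot); [CSpec s n sb] is (s, n, sb). *)
Inductive contract_state : Type :=
  | CArch (s : arch_state)
  | CSpec (s : arch_state) (n : nat) (sb : arch_state).

Definition contract_next (w : nat) (P : program) (q : contract_state)
    : contract_state :=
  match q with
  | CArch s =>
      match fetch P s with
      | IBeqz x l =>
          CSpec (set_pc s (if is_zero s x then S (st_pc s) else l)) w
                (isa_step s (IBeqz x l))
      | i => CArch (isa_step s i)
      end
  | CSpec s 0 sb => CArch sb
  | CSpec s (S n) sb => CSpec (isa_step s (fetch P s)) n sb
  end.

Definition contract_leak (P : program) (q : contract_state) : contract_obs :=
  match q with
  | CSpec s 0 sb => ObsBot
  | CArch s | CSpec s (S _) _ => instr_obs s (fetch P s)
  end.

Definition contract (w : nat) (P : program) : transition_system :=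
  TransitionSystem contract_state contract_obs
    (contract_next w P) (contract_leak P).

(* The transitions of the contract as inference rules; [contract_ruleP] shows
   that they agree with [contract]. The rule Step is split according to whether
   the window is infinite, using oo + 1 = oo. *)
Inductive contract_rule (w : nat) (P : program)
    : contract_state -> contract_obs -> contract_state -> Prop :=
  | contract_step_arch s :
      is_beqz (fetch P s) = false ->
      contract_rule w P (CArch s) (instr_obs s (fetch P s))
        (CArch (isa_step s (fetch P s)))
  | contract_step_spec s n sb :
      contract_rule w P (CSpec s (S n) sb) (instr_obs s (fetch P s))
        (CSpec (isa_step s (fetch P s)) n sb)
  | contract_rollback s sb :
      contract_rule w P (CSpec s 0 sb) ObsBot (CArch sb)
  | contract_branch s x l :
      fetch P s = IBeqz x l ->
      contract_rule w P (CArch s) (ObsBool (is_zero s x))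
        (CSpec (set_pc s (if is_zero s x then S (st_pc s) else l)) w
               (isa_step s (IBeqz x l))).

Lemma contract_ruleP w P q o q' :
  transition (contract w P) q o q' <-> contract_rule w P q o q'.
Proof.
unfold transition; simpl; split.
- intros [-> ->].
  destruct q as [s | s [| n] sb]; simpl; try constructor.
  destruct (fetch P s) as [x1 x2 | x1 x2 k | x l] eqn:E.
  1,2: rewrite <- E; constructor; now rewrite E.
  now constructor.
- intros H; destruct H as [s E | | | s x l E]; simpl; try now split.
  + destruct (fetch P s); simpl in *; now split.
  + now rewrite E.
Qed.

Inductive prediction : Type := Pjump | Pnext.
Definition predictor : Type := nat -> prediction.

(* [HArch s] is (s, oo, bot); [HSpec s n b sb] is (s, n, (b, sb)). *)
Inductive spec_state : Type :=
  | HArch (s : hw_state)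
  | HSpec (s : hw_state) (n : nat) (b : bool) (sb : arch_state).

Definition spec_pc (p : prediction) (s : arch_state) (l : nat) : nat :=
  match p with
  | Pnext => S (st_pc s)
  | Pjump => l
  end.

Definition hardware_next (w : nat) (Phi : predictor) (P : program)
    (q : spec_state) : spec_state :=
  match q with
  | HArch s =>
      match fetch P (hw_arch s) with
      | IBeqz x l =>
          let s' := isa_step (hw_arch s) (IBeqz x l) in
          let n := spec_pc (Phi (st_pc (hw_arch s))) (hw_arch s) l in
          HSpec (hw_set_pc s n) w (Nat.eqb (st_pc s') n) s'
      | i => HArch (hw_step s i)
      end
  | HSpec s 0 false sb => HArch (HW sb (hw_cache s))
  | HSpec s 0 true sb => HArch s
  | HSpec s (S n) b sb => HSpec (hw_step s (fetch P (hw_arch s))) n b sb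
  end.

Definition hardware_leak (q : spec_state) : cache :=
  match q with
  | HArch s | HSpec s _ _ _ => hw_cache s
  end.

Definition hardware (w : nat) (Phi : predictor) (P : program)
    : transition_system :=
  TransitionSystem spec_state cache (hardware_next w Phi P) hardware_leak.

(* The transitions of the hardware as inference rules; see [hardware_ruleP]. *)
Inductive hardware_rule (w : nat) (Phi : predictor) (P : program)
    : spec_state -> cache -> spec_state -> Prop :=
  | hardware_rollback s sb :
      hardware_rule w Phi P (HSpec s 0 false sb) (hw_cache s)
        (HArch (HW sb (hw_cache s)))
  | hardware_commit s sb :
      hardware_rule w Phi P (HSpec s 0 true sb) (hw_cache s) (HArch s)
  | hardware_step_arch s :
      is_beqz (fetch P (hw_arch s)) = false ->
      hardware_rule w Phi P (HArch s) (hw_cache s)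
        (HArch (hw_step s (fetch P (hw_arch s))))
  | hardware_step_spec s n b sb :
      hardware_rule w Phi P (HSpec s (S n) b sb) (hw_cache s)
        (HSpec (hw_step s (fetch P (hw_arch s))) n b sb)
  | hardware_branch_next s x l s' :
      fetch P (hw_arch s) = IBeqz x l ->
      Phi (st_pc (hw_arch s)) = Pnext ->
      s' = isa_step (hw_arch s) (IBeqz x l) ->
      hardware_rule w Phi P (HArch s) (hw_cache s)
        (HSpec (hw_set_pc s (S (st_pc (hw_arch s)))) w
               (Nat.eqb (st_pc s') (S (st_pc (hw_arch s)))) s')
  | hardware_branch_jump s x l s' :
      fetch P (hw_arch s) = IBeqz x l ->
      Phi (st_pc (hw_arch s)) = Pjump ->
      s' = isa_step (hw_arch s) (IBeqz x l) ->
      hardware_rule w Phi P (HArch s) (hw_cache s)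
        (HSpec (hw_set_pc s l) w (Nat.eqb (st_pc s') l) s').

Lemma hardware_ruleP w Phi P q o q' :
  transition (hardware w Phi P) q o q' <-> hardware_rule w Phi P q o q'.
Proof.
unfold transition; simpl; split.
- intros [-> ->].
  destruct q as [s | s [| n] [] sb]; simpl; try constructor.
  destruct (fetch P (hw_arch s)) as [x1 x2 | x1 x2 k | x l] eqn:E.
  1,2: rewrite <- E; constructor; now rewrite E.
  destruct (Phi (st_pc (hw_arch s))) eqn:F; simpl.
  + now apply (hardware_branch_jump w Phi P s x l).
  + now apply (hardware_branch_next w Phi P s x l).
- intros H; destruct H as [ | | s E | | s x l s' E F -> | s x l s' E F ->];
    simpl; try now split.
  + destruct (fetch P (hw_arch s)); simpl in *; now split.
  + now rewrite E, F.
  + now rewrite E, F.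
Qed.

(* Main.v *)
From Stdlib Require Import ZArith List Bool.
Require Import Defs.

(** Contract-equivalent architectural states with equal program counters stay so
    after one architectural step: at a branch, this is what the contract reaches
    after exploring and rolling back the mispredicted path. Hence the contract
    covers every architectural path, and so the correctly predicted speculation
    of the hardware, although the two systems run out of step with each other.
    A wrongly predicted speculation takes exactly the path which the contract
    explores. In both cases the contract leaks the loaded addresses, which
    determine the cache, and the branch outcomes, which determine the program
    counter. *)

Definition trace_equiv (T : transition_system) (q1 q2 : ts_state T) : Prop :=
  forall n, trace T q1 n = trace T q2 n.

Lemma trace_equiv_leak T q1 q2 :
  trace_equiv T q1 q2 -> leak T q1 = leak T q2.
Proof. intros H; exact (H 0). Qed.

Lemma trace_equiv_next T q1 q2 :
  trace_equiv T q1 q2 -> trace_equiv T (next T q1) (next T q2).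
Proof.
intros H n; specialize (H (S n)); unfold trace in *.
now rewrite !Nat.iter_succ_r in H.
Qed.

Lemma trace_equiv_bisim T (R : ts_state T -> ts_state T -> Prop) :
  (forall q1 q2, R q1 q2 -> leak T q1 = leak T q2) ->
  (forall q1 q2, R q1 q2 -> R (next T q1) (next T q2)) ->
  forall q1 q2, R q1 q2 -> trace_equiv T q1 q2.
Proof.
intros Hleak Hnext q1 q2 HR n; apply Hleak.
induction n as [| n IH]; simpl; auto.
Qed.

(** Only a branch makes the next program counter depend on data, and its observation is exactly its
    outcome. *)
Lemma isa_step_pc_eq i s1 s2 :
  st_pc s1 = st_pc s2 -> instr_obs s1 i = instr_obs s2 i ->
  st_pc (isa_step s1 i) = st_pc (isa_step s2 i).
Proof.
destruct s1 as [m1 a1 pc1], s2 as [m2 a2 pc2]; simpl; intros <- Hobs.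
destruct i as [x1 x2 | x1 x2 k | x l]; simpl in *; try reflexivity.
unfold is_zero in Hobs; simpl in Hobs.
now injection Hobs as ->.
Qed.

Lemma hw_step_cache_eq i s1 s2 :
  hw_cache s1 = hw_cache s2 ->
  instr_obs (hw_arch s1) i = instr_obs (hw_arch s2) i ->
  hw_cache (hw_step s1 i) = hw_cache (hw_step s2 i).
Proof.
intros Hc Hobs; destruct i as [x1 x2 | x1 x2 k | x l]; simpl in *; auto.
injection Hobs as ->; now rewrite Hc.
Qed.

Lemma isa_step_beqz s x l :
  isa_step s (IBeqz x l) = set_pc s (if is_zero s x then l else S (st_pc s)).
Proof. now destruct s. Qed.

Section Simulation.

Variables (w : nat) (Phi : predictor) (P : program).

(** The contract does not leak program counters, so their equality is required separately. *)
Definition arch_equiv (s1 s2 : arch_state) : Prop :=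
  st_pc s1 = st_pc s2 /\ trace_equiv (contract w P) (CArch s1) (CArch s2).

Lemma fetch_eq s1 s2 : st_pc s1 = st_pc s2 -> fetch P s1 = fetch P s2.
Proof. unfold fetch; now intros ->. Qed.

(** Both runs share the window [n], so they roll back at the same time, and no earlier step changes
    the backup states. *)
Lemma trace_equiv_rollback n s1 s2 sb1 sb2 :
  trace_equiv (contract w P) (CSpec s1 n sb1) (CSpec s2 n sb2) ->
  trace_equiv (contract w P) (CArch sb1) (CArch sb2).
Proof.
revert s1 s2; induction n as [| n IH]; intros s1 s2 H;
  apply trace_equiv_next in H; simpl in H; eauto.
Qed.

Lemma arch_equiv_obs s1 s2 :
  arch_equiv s1 s2 ->
  instr_obs s1 (fetch P s2) = instr_obs s2 (fetch P s2).
Proof.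
intros [Hpc H]; apply trace_equiv_leak in H; simpl in H.
now rewrite (fetch_eq _ _ Hpc) in H.
Qed.

Lemma arch_equiv_step s1 s2 :
  arch_equiv s1 s2 ->
  arch_equiv (isa_step s1 (fetch P s2)) (isa_step s2 (fetch P s2)).
Proof.
intros H; split.
- apply isa_step_pc_eq; [apply H | now apply arch_equiv_obs].
- destruct H as [Hpc H]; apply trace_equiv_next in H; simpl in H.
  rewrite (fetch_eq _ _ Hpc) in H.
  destruct (fetch P s2); try exact H.
  exact (trace_equiv_rollback _ _ _ _ _ H).
Qed.

(* After a correct prediction ([b = true]) the speculative state is already on
   the architectural path, and the backup state is irrelevant. *)
Inductive hw_equiv : spec_state -> spec_state -> Prop :=
  | hw_equiv_arch s1 s2 :
      hw_cache s1 = hw_cache s2 ->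
      arch_equiv (hw_arch s1) (hw_arch s2) ->
      hw_equiv (HArch s1) (HArch s2)
  | hw_equiv_correct s1 s2 n sb1 sb2 :
      hw_cache s1 = hw_cache s2 ->
      arch_equiv (hw_arch s1) (hw_arch s2) ->
      hw_equiv (HSpec s1 n true sb1) (HSpec s2 n true sb2)
  | hw_equiv_wrong s1 s2 n sb1 sb2 :
      hw_cache s1 = hw_cache s2 ->
      st_pc (hw_arch s1) = st_pc (hw_arch s2) ->
      st_pc sb1 = st_pc sb2 ->
      trace_equiv (contract w P) (CSpec (hw_arch s1) n sb1)
        (CSpec (hw_arch s2) n sb2) ->
      hw_equiv (HSpec s1 n false sb1) (HSpec s2 n false sb2).

Lemma hw_equiv_leak q1 q2 :
  hw_equiv q1 q2 -> hardware_leak q1 = hardware_leak q2.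
Proof. now intros []. Qed.

Lemma hw_equiv_branch s1 s2 x l n :
  hw_cache s1 = hw_cache s2 ->
  arch_equiv (hw_arch s1) (hw_arch s2) ->
  fetch P (hw_arch s2) = IBeqz x l ->
  n = l \/ n = S (st_pc (hw_arch s2)) ->
  let s1' := isa_step (hw_arch s1) (IBeqz x l) in
  let s2' := isa_step (hw_arch s2) (IBeqz x l) in
  hw_equiv (HSpec (hw_set_pc s1 n) w (Nat.eqb (st_pc s1') n) s1')
           (HSpec (hw_set_pc s2 n) w (Nat.eqb (st_pc s2') n) s2').
Proof.
intros Hc H E Hn s1' s2'.
pose proof (arch_equiv_obs _ _ H) as Hz.
pose proof (arch_equiv_step _ _ H) as Hstep.
rewrite E in Hz, Hstep; simpl in Hz; injection Hz as Hz.
fold s1' s2' in Hstep.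
(* Equal successor counters make both runs agree on whether the prediction [n] is correct. *)
pose proof (proj1 Hstep) as Hpc'; rewrite Hpc'.
destruct (Nat.eqb_spec (st_pc s2') n) as [Heq | Hneq].
- apply hw_equiv_correct; [exact Hc |].
  (* A branch changes only the program counter, so a correct prediction already performs the
     architectural step. *)
  assert (Es : forall s, st_pc (isa_step s (IBeqz x l)) = n ->
                         set_pc s n = isa_step s (IBeqz x l))
    by (intros s; rewrite isa_step_beqz; now intros <-).
  simpl; rewrite !Es by (fold s1' s2'; congruence).
  exact Hstep.
- apply hw_equiv_wrong; [exact Hc | reflexivity | exact Hpc' |].
  destruct H as [Hpc H]; apply trace_equiv_next in H; simpl in H.
  rewrite (fetch_eq _ _ Hpc), E, Hz, Hpc in H.
  unfold s2' in Hneq; rewrite isa_step_beqz in Hneq; simpl in Hneq.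
  (* [Hneq] excludes the actual target, so [n] is the other one, which the contract explores. *)
  replace (if is_zero (hw_arch s2) x then S (st_pc (hw_arch s2)) else l)
    with n in H; [exact H |].
  destruct (is_zero (hw_arch s2) x), Hn; congruence.
Qed.

Lemma hw_equiv_next q1 q2 :
  hw_equiv q1 q2 ->
  hw_equiv (hardware_next w Phi P q1) (hardware_next w Phi P q2).
Proof.
intros [s1 s2 Hc H | s1 s2 [| n] sb1 sb2 Hc H
       | s1 s2 [| n] sb1 sb2 Hc Hpc Hsb H]; simpl.
- pose proof (arch_equiv_obs _ _ H) as Hobs.
  pose proof (arch_equiv_step _ _ H) as Hstep.
  rewrite (fetch_eq _ _ (proj1 H)).
  destruct (fetch P (hw_arch s2)) as [x1 x2 | x1 x2 k | x l] eqn:E.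
  1,2: apply hw_equiv_arch; [now apply hw_step_cache_eq | exact Hstep].
  replace (spec_pc (Phi (st_pc (hw_arch s1))) (hw_arch s1) l)
    with (spec_pc (Phi (st_pc (hw_arch s2))) (hw_arch s2) l)
    by (unfold spec_pc; now rewrite (proj1 H)).
  apply hw_equiv_branch; auto.
  destruct (Phi (st_pc (hw_arch s2))); simpl; auto.
- now apply hw_equiv_arch.
(* A branch met during speculation is an ordinary hardware step, whereas the contract makes a detour
   here, which [arch_equiv_step] skips. *)
- rewrite (fetch_eq _ _ (proj1 H)).
  apply hw_equiv_correct; [| now apply arch_equiv_step].
  apply hw_step_cache_eq; [exact Hc | now apply arch_equiv_obs].
(* Rollback keeps the cache, so the caches have to agree on the wrong path too. *)
- apply hw_equiv_arch; [exact Hc |].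
  exact (conj Hsb (trace_equiv_rollback _ _ _ _ _ H)).
(* On the wrong path, hardware and contract move in lockstep with the same remaining window. *)
- pose proof (trace_equiv_leak _ _ _ H) as Hobs; simpl in Hobs.
  apply trace_equiv_next in H; simpl in H.
  rewrite (fetch_eq _ _ Hpc) in *.
  apply hw_equiv_wrong; auto.
  + now apply hw_step_cache_eq.
  + now apply isa_step_pc_eq.
Qed.

End Simulation.

Theorem mainTheorem7 (w : nat) (Phi : predictor) (P : program)
    (m1 m2 : memory) (a1 a2 : registers) (c : cache) (pc : nat) :
  (forall n : nat,
     trace (contract w P) (CArch (Arch m1 a1 pc)) n
     = trace (contract w P) (CArch (Arch m2 a2 pc)) n) ->
  (forall n : nat,
     trace (hardware w Phi P) (HArch (HW (Arch m1 a1 pc) c)) n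
     = trace (hardware w Phi P) (HArch (HW (Arch m2 a2 pc) c)) n).
Proof.
intros H.
apply (trace_equiv_bisim (hardware w Phi P) (hw_equiv w P)).
- apply hw_equiv_leak.
- apply hw_equiv_next.
- now apply hw_equiv_arch.
Qed.
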